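(* Let $R_1\in\mathbb{R}^{2k\times k}$ be the matrix whose columns are the last $k$ canonical directions of $(X^2;X^3)$ in the canonical correlation analysis (CCA) between $X^1$ and $(X^2;X^3)$, and let $R_2\in\mathbb{R}^{2k\times k}$ be the matrix whose columns are the last $k$ canonical directions of $(X^1;X^2)$ in the CCA between $X^3$ and $(X^1;X^2)$. Write $$R_1=\begin{pmatrix}R_{11}\\R_{21}\end{pmatrix},\qquad R_2=\begin{pmatrix}R_{12}\\R_{22}\end{pmatrix}$$ with all blocks $k\times k$, and let $$R=\begin{pmatrix}0&R_{12}\\R_{11}&R_{22}\\R_{21}&0\end{pmatrix}\in\mathbb{R}^{3k\times 2k}.$$ Suppose that $R$ has full rank $2k$. Put $Q=\Sigma_{X,X}^{1/2}$ and $\widetilde P_2=QR$, let $\widetilde P_1\in\mathbb{R}^{3k\times k}$ be a matrix whose columns form a basis of the orthogonal complement in $\mathbb{R}^{3k}$ of the column space of $\widetilde P_2$, and set $\widetilde U_1=Q^{-1}\widetilde P_1$. Then: (i) the column space of $R$ equals the column space of $U_2$, and the column space of $\widetilde U_1$ equals the column space of $U_1$, where $U_0=(U_1,U_2)$ is the CCA rotation matrix of $X$ in the CCA between $X$ and $H$; (ii) the optimal linear predictor of $Y$ (in square loss) based on the $k$-dimensional feature $\widetilde U_1^TX$ is the same as the optimal linear predictor of $Y$ based on the $3k$-dimensional feature $X$.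
   Context: Setting. $H$ is a $k$-dimensional random vector (the hidden state), $X^1,X^2,X^3$ are $k$-dimensional random vectors (the views), and $Y$ is a real random variable. All have mean zero and finite second moments, and $\mathbb{E}[HH^T]=I_k$. Assume: - (Conditional independence) conditionally on $H$, the variables $Y,X^1,X^2,X^3$ are independent; - (Linearity) $\mathbb{E}[X^i|H]=M_iH$ for $i=1,2,3$ and $\mathbb{E}[Y|H]=M_YH$, for matrices $M_i\in\mathbb{R}^{k\times k}$ and $M_Y\in\mathbb{R}^{1\times k}$; - (Full rank) $M_1,M_2,M_3$ have rank $k$. $X=(X^1;X^2;X^3)$ is the $3k\times 1$ concatenation of the views; $(X^2;X^3)$ and $(X^1;X^2)$ are the analogous $2k\times 1$ concatenations. $\Sigma_{A,B}=\mathbb{E}[AB^T]$ denotes the covariance matrix of mean-zero random vectors $A,B$. $\Sigma_{X,X}$ is invertible, and $\Sigma_{X,X}^{1/2}$ is its symmetric positive definite square root. CCA. For mean-zero random vectors $A\in\mathbb{R}^m$, $B\in\mathbb{R}^n$ with invertible covariance matrices, take a full singular value decomposition $\Sigma_{A,A}^{-1/2}\Sigma_{A,B}\Sigma_{B,B}^{-1/2}=SDT^T$ with singular values in decreasing order. The canonical directions of $A$ are the columns of $\Sigma_{A,A}^{-1/2}S$ and those of $B$ are the columns of $\Sigma_{B,B}^{-1/2}T$, in this order. The canonical variables are the corresponding linear combinations of $A$ and of $B$. CCA between $X$ and $H$. Let $X''=Q^{-1}X$, with full singular value decomposition $\Sigma_{X'',H}=PDV_0^T$ (singular values decreasing). Write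 $P=(P_1,P_2)$, with $P_1$ the first $k$ columns and $P_2$ the last $2k$ columns. Then $U_0=(U_1,U_2)=Q^{-1}P$, i.e. $U_1=Q^{-1}P_1$ and $U_2=Q^{-1}P_2$. The optimal linear predictor of $Y$ based on a random vector $Z$ is the random variable $w^TZ$ minimizing $\mathbb{E}[(Y-w^TZ)^2]$ over vectors $w$. *)

(* Defs.v *)
From HB Require Import structures.
From mathcomp Require Import all_boot all_order all_algebra.
From mathcomp Require Import all_classical all_reals all_analysis.
Set Implicit Arguments.
Unset Strict Implicit.
Unset Printing Implicit Defensive.
Import Order.TTheory GRing.Theory Num.Theory.
Import numFieldNormedType.Exports.
Local Open Scope classical_set_scope.
Local Open Scope ring_scope.

Section LinearAlgebra.
Context {R : realType}.

Definition orthogonal_mx n (S : 'M[R]_n) : Prop := S^T *m S = 1%:M.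

Definition spd_sqrt n (A Q : 'M[R]_n) : Prop :=
  [/\ Q^T = Q,
      forall v : 'cV[R]_n, v != 0 -> 0 < (v^T *m Q *m v) 0 0
    & Q *m Q = A].

(* Full singular value decomposition A = S D T^T: D has the size of A, and its
   diagonal entries are nonnegative and nonincreasing. *)
Definition full_svd m n (A : 'M[R]_(m, n)) (S : 'M[R]_m) (D : 'M[R]_(m, n))
    (T : 'M[R]_n) : Prop :=
  [/\ A = S *m D *m T^T,
      orthogonal_mx S /\ orthogonal_mx T,
      forall (i : 'I_m) (j : 'I_n), (i : nat) <> j -> D i j = 0,
      forall i j, 0 <= D i j
    & forall (i i' : 'I_m) (j j' : 'I_n),
        (i : nat) = j -> (i' : nat) = j' -> (i <= i')%N ->
        D i' j' <= D i j].

(* MathComp's (_ <= _)%MS and (_ :=: _)%MS compare row spaces, whence the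
   transpositions below. *)
Definition same_col_space m n p (A : 'M[R]_(m, n)) (B : 'M[R]_(m, p)) : Prop :=
  (A^T :=: B^T)%MS.

(* The columns of B form a basis of the orthogonal complement of the column
   space of A. *)
Definition basis_of_orth_compl m n p (A : 'M[R]_(m, n)) (B : 'M[R]_(m, p)) :
    Prop :=
  row_free B^T /\
  forall v : 'cV[R]_m,
    (v^T <= B^T)%MS <->
    (forall u : 'cV[R]_m, (u^T <= A^T)%MS -> u^T *m v = 0).

End LinearAlgebra.

Section Probability.
Context {d : measure_display} {T : measurableType d} {R : realType}.
Variable P : probability T R.

(* Lfun P 2 is the set of measurable functions with finite L^2 norm. *)
Definition centered_L2 (f : T -> R) : Prop :=
  f \in Lfun P 2%:E /\ ('E_P[f] = 0)%E.

Definition centered_L2_vec n (X : T -> 'cV[R]_n) : Prop :=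
  forall i, centered_L2 (fun t => X t i 0).

(* E[A B^T]; covariance matrix of A and B when these are centered. *)
Definition covmx m n (A : T -> 'cV[R]_m) (B : T -> 'cV[R]_n) : 'M[R]_(m, n) :=
  \matrix_(i, j) fine 'E_P[fun t => (A t i 0 * B t j 0)%R]%E.

Definition sigma_rv (f : T -> R) : set_system T :=
  preimage_set_system setT f measurable.

Definition sigma_vec n (X : T -> 'cV[R]_n) : set_system T :=
  g_sigma_preimage (fun (i : 'I_n) t => X t i 0).

(* W is a version of the conditional expectation E[f | G]. *)
Definition is_cond_exp (G : set_system T) (f W : T -> R) : Prop :=
  [/\ P.-integrable setT (EFin \o f),
      P.-integrable setT (EFin \o W),
      sigma_rv W `<=` G
    & forall A, G A -> (\int[P]_(t in A) (W t)%:E = \int[P]_(t in A) (f t)%:E)%E].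

Definition is_cond_exp_vec n (G : set_system T) (X W : T -> 'cV[R]_n) : Prop :=
  forall i, is_cond_exp G (fun t => X t i 0) (fun t => W t i 0).

Definition is_cond_prob (G : set_system T) (A : set T) (p : T -> R) : Prop :=
  is_cond_exp G \1_A p.

(* Conditional independence given G of the sigma-algebras F_0, ..., F_(n-1):
   P(A_0 /\ ... /\ A_(n-1) | G) = P(A_0 | G) ... P(A_(n-1) | G) a.s. whenever
   A_i is in F_i. Versions of conditional probabilities exist and are a.s.
   unique, so the choice of versions is immaterial; the product rule over
   subfamilies is the case where some of the A_i are the whole space. *)
Definition cond_indep n (G : set_system T) (F : 'I_n -> set_system T) : Prop :=
  forall A : 'I_n -> set T, (forall i, F i (A i)) ->
  exists p : 'I_n -> T -> R,
    (forall i, is_cond_prob G (A i) (p i)) /\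
    is_cond_prob G [set t | forall i, A i t] (fun t => \prod_(i < n) p i t).

(* U (resp. V) is a matrix whose columns are, in order, the canonical
   directions of A (resp. B) in the CCA between A and B, for some choice of
   the singular value decomposition. *)
Definition canonical_directions m n (A : T -> 'cV[R]_m) (B : T -> 'cV[R]_n)
    (U : 'M[R]_m) (V : 'M[R]_n) : Prop :=
  exists QA QB S D S',
    [/\ spd_sqrt (covmx A A) QA, spd_sqrt (covmx B B) QB,
        full_svd (invmx QA *m covmx A B *m invmx QB) S D S',
        U = invmx QA *m S
      & V = invmx QB *m S'].

(* W is a random variable w^T Z minimizing E[(Y - w^T Z)^2] over w. *)
Definition optimal_linear_predictor n (Y : T -> R) (Z : T -> 'cV[R]_n)
    (W : T -> R) : Prop :=
  exists w : 'cV[R]_n,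
    W = (fun t => (w^T *m Z t) 0 0) /\
    forall v : 'cV[R]_n,
      ('E_P[fun t => ((Y t - W t) ^+ 2)%R]
        <= 'E_P[fun t => ((Y t - (v^T *m Z t) 0 0) ^+ 2)%R])%E.

End Probability.

(* Main.v *)
Require Import Defs.
From HB Require Import structures.
From mathcomp Require Import all_boot all_order all_algebra.
From mathcomp Require Import finmap.
From mathcomp Require Import all_classical all_reals all_analysis.
From mathcomp Require Import lra zify.
Set Implicit Arguments.
Unset Strict Implicit.
Unset Printing Implicit Defensive.
Import Order.TTheory GRing.Theory Num.Theory.
Import numFieldNormedType.Exports.
Import measurable_realfun HBNNSimple.
Local Open Scope classical_set_scope.
Local Open Scope ring_scope.

(** Write [M = (M1; M2; M3)] and [S = Sigma_XX = Q^2]. Conditional independence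
    and linearity give [Sigma_{Xi,Xj} = Mi Mj^T] for [i <> j],
    [Sigma_{X,H} = M] and [Sigma_{X,Y} = M MY^T]. Hence
    [Sigma_{X1,(X2;X3)} = M1 (M2^T M3^T)], and the last canonical directions
    lie in the kernel of [(M2^T M3^T)]; the same for [X3] and [(X1;X2)] yields
    [M^T RR = 0]. By the singular value decomposition of [Q^-1 M] also
    [M^T U2 = 0], and both matrices have rank [2k = dim ker M^T]. Dually, the
    columns of [Q Pt1] and of [Q P1] both span the column space of [M], so
    those of [Ut1] and [U1] span the column space of [S^-1 M]. The latter
    contains the weight vector [S^-1 M MY^T] of the optimal predictor of [Y]
    from [X], which is therefore also optimal from [Ut1^T X]. *)

(** * Functions whose integral vanishes on every set of a sub-sigma-algebra *)

Lemma integral_indicr d (T : measurableType d) (R : realType)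
    (mu : measure T R) (A : set T) (f : T -> R) :
  (\int[mu]_(x in A) (f x)%:E = \int[mu]_x (f x * \1_A x)%:E)%E.
Proof.
rewrite integral_mkcond; apply: eq_integral => x _.
by rewrite patchE indicE; case: (x \in A); rewrite ?mulr1 ?mulr0.
Qed.

Definition sub_sigma_algebra_of d (T : measurableType d) (G : set_system T) :=
  sigma_algebra setT G /\ G `<=` measurable.

(** Here [h] is read as a function on [T] equipped with the sigma-algebra generated by [G], so that
    general results on measurable functions apply to it. *)
Definition measurable_wrt (T : pointedType) (R : realType) (G : set_system T)
    (h : T -> R) :=
  measurable_fun setT (h : g_sigma_algebraType G -> R).

Lemma measurable_wrtP d (T : measurableType d) (R : realType)
    (G : set_system T) (h : T -> R) :
  sub_sigma_algebra_of G -> measurable_wrt G h <-> sigma_rv h `<=` G.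
Proof.
move=> [sG _]; split => [mh _ [B mB <-]|sub _ B mB].
  by rewrite -[G](sigma_algebra_id sG); exact: mh.
by apply: sub_sigma_algebra; apply: sub; exists B.
Qed.

Lemma measurable_wrt_sub d (T : measurableType d) (R : realType)
    (G : set_system T) (h : T -> R) :
  sub_sigma_algebra_of G -> measurable_wrt G h -> measurable_fun setT h.
Proof.
move=> sG /(measurable_wrtP _ sG) sub _ B mB.
by apply: sG.2; apply: sub; exists B.
Qed.

Lemma measurable_wrt_set d (T : measurableType d)
    (G : set_system T) (A : set (g_sigma_algebraType G)) :
  sub_sigma_algebra_of G -> measurable A -> G A.
Proof. by move=> [sG _]; rewrite /measurable/= sigma_algebra_id. Qed.

(* The simple functions approximating [h] have to be measurable for [G], so they
   are taken on the type [T] equipped with the sigma-algebra [G]. *)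
Lemma integral_mul_eq0_nneg d (T : measurableType d) (R : realType)
    (P : probability T R) (G : set_system T) (u h : T -> R) :
  sub_sigma_algebra_of G ->
  P.-integrable setT (EFin \o u) ->
  (forall A, G A -> (\int[P]_(t in A) (u t)%:E = 0)%E) ->
  measurable_wrt G h -> (forall t, 0 <= h t) ->
  P.-integrable setT (fun t => (u t * h t)%:E) ->
  (\int[P]_t (u t * h t)%:E = 0)%E.
Proof.
move=> sG iu u0 mh h0 iuh.
have mu : measurable_fun setT u by exact/measurable_EFinP/(measurable_int P).
have mh' : measurable_fun setT (EFin \o (h : g_sigma_algebraType G -> R)).
  exact/measurable_EFinP.
pose phi := nnsfun_approx (@measurableT _ (g_sigma_algebraType G)) mh'.
have mphi n : measurable_fun setT (phi n : T -> R).
  apply: (measurable_wrt_sub sG).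
  exact: (measurable_funPT (phi n)).
have hE x : (phi n x)%:E @[n --> \oo] --> (h x)%:E.
  by apply: (cvg_nnsfun_approx _ mh') => // ? _; rewrite lee_fin.
have phile n x : phi n x <= h x.
  rewrite -lee_fin.
  have ndphi : nondecreasing_seq (fun n => (phi n x)%:E).
    move=> i j ij; rewrite lee_fin.
    by have /lefP/(_ x) := nd_nnsfun_approx measurableT mh' ij.
  have /cvg_lim <- // := hE x.
  rewrite (cvg_lim _ (ereal_nondecreasing_cvgn ndphi))//.
  by apply: ereal_sup_ubound; exists n.
have phi0 n : (\int[P]_t (u t * phi n t)%:E = 0)%E.
  (* A simple function is the finite sum of its values times the indicators of its level sets, and
     these level sets belong to [G]. *)
  have -> : (fun t => (u t * phi n t)%:E) =
     (fun t => \sum_(y <- fset_set (range (phi n)))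
        (y%:E * (u t * \1_(phi n @^-1` [set y]) t)%:E)%E).
    apply/funext => t; rewrite {1}fimfunE fsbig_finite//= mulr_sumr -sumEFin.
    by apply: eq_bigr => y _; rewrite mulrCA EFinM.
  have iy y : P.-integrable setT (fun t => (u t * \1_(phi n @^-1` [set y]) t)%:E).
    apply: (le_integrable measurableT _ _ iu).
      apply/measurable_EFinP/measurable_funM => //.
      apply: measurable_indic; rewrite -[_ @^-1` _]setTI.
      exact: (mphi n measurableT).
    move=> t _ /=; rewrite lee_fin normrM indicE.
    by case: (_ \in _); rewrite ?normr1 ?normr0 ?mulr1 ?mulr0.
  rewrite integral_sum//=; last by move=> y; apply: integrableZl => //.
  rewrite big1// => y _.
  rewrite integralZl// -integral_indicr u0 ?mule0//.
  by apply: measurable_wrt_set => //; exact: measurable_sfunP.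
(* The dominating function is [|u h|], because [0 <= phi n <= h]. *)
have [|||||_ _] := @dominated_convergence _ _ _ P setT measurableT
  (fun n t => (u t * phi n t)%:E) (fun t => (u t * h t)%:E)
  (abse \o (fun t => (u t * h t)%:E)).
- by move=> n; apply/measurable_EFinP/measurable_funM.
- exact: measurable_int iuh.
- apply: aeW => t _; under eq_fun do rewrite EFinM.
  rewrite EFinM; apply: cvgeZl => //.
- exact: integrable_abse.
- apply: aeW => t n _ /=; rewrite lee_fin !normrM ler_wpM2l//.
  by rewrite !ger0_norm.
move=> /cvg_lim <- //.
rewrite (_ : (fun _ => _) = cst 0%E) ?lim_cst//.
by apply/funext => n; exact: phi0.
Qed.

(** Reduction to the nonnegative case: the positive and negative parts of [h] are bounded by [|h|],
    so their products with [u] remain integrable. *)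
Lemma integral_mul_eq0 d (T : measurableType d) (R : realType)
    (P : probability T R) (G : set_system T) (u h : T -> R) :
  sub_sigma_algebra_of G ->
  P.-integrable setT (EFin \o u) ->
  (forall A, G A -> (\int[P]_(t in A) (u t)%:E = 0)%E) ->
  measurable_wrt G h ->
  P.-integrable setT (fun t => (u t * h t)%:E) ->
  (\int[P]_t (u t * h t)%:E = 0)%E.
Proof.
move=> sG iu u0 mh iuh.
have mu : measurable_fun setT u by exact/measurable_EFinP/(measurable_int P).
have mhN : measurable_wrt G (fun t => - h t).
  exact: (measurableT_comp (@oppr_measurable R setT) mh).
(* Taking [g = h] gives the positive part of [h], and [g = - h] the negative part. *)
have part (g : T -> R) : measurable_wrt G g -> (forall t, `|g t| = `|h t|) ->
    P.-integrable setT (fun t => (u t * Num.max (g t) 0)%:E) /\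
    (\int[P]_t (u t * Num.max (g t) 0)%:E = 0)%E.
  move=> mg gh.
  have mg0 : measurable_wrt G (fun t => Num.max (g t) 0).
    exact: measurable_funrpos.
  have ig0 : P.-integrable setT (fun t => (u t * Num.max (g t) 0)%:E).
    apply: le_integrable iuh => //.
      apply/measurable_EFinP/measurable_funM => //.
      exact: measurable_wrt_sub mg0.
    move=> t _ /=; rewrite lee_fin !normrM ler_wpM2l// -gh.
    by case: (lerP (g t) 0) => _; rewrite ?normr0 ?normr_ge0 ?lexx.
  split=> //; apply: (integral_mul_eq0_nneg sG (u := u)) => //.
  by move=> t; rewrite le_max lexx orbT.
have [ip p0] := part h mh (fun=> erefl).
have [iN n0] := part (fun t => - h t) mhN (fun t => normrN (h t)).
transitivity (\int[P]_t (u t * Num.max (h t) 0)%:E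
              - \int[P]_t (u t * Num.max (- h t) 0)%:E)%E.
  rewrite -integralB_EFin//.
  apply: eq_integral => t _; rewrite -EFinB -mulrBr; congr (_ * _)%:E.
  by case: (lerP (h t) 0) => h0; case: lerP => h1; lra.
by rewrite p0 n0 sube0.
Qed.

(** On the set where [w] is negative, its integral is minus that of [|w|]. The hypothesis makes the
    latter vanish, so [w = 0] a.e. on that set, which is therefore null. *)
Lemma ae_ge0_integral_neg d (T : measurableType d) (R : realType)
    (P : probability T R) (w : T -> R) :
  P.-integrable setT (EFin \o w) ->
  (0 <= \int[P]_(t in [set t | (w t < 0)%R]) (w t)%:E)%E ->
  {ae P, forall t, 0 <= w t}.
Proof.
move=> iw i0; set D := [set t | w t < 0].
have mw : measurable_fun setT w by exact/measurable_EFinP/(measurable_int P).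
have mD : measurable D.
  have -> : D = w @^-1` `]-oo, 0[ by apply/seteqP; split=> t; rewrite /= in_itv.
  by rewrite -[_ @^-1` _]setTI; exact: mw.
have iwD : P.-integrable D (EFin \o w) by exact: integrableS iw.
have a0 : (\int[P]_(t in D) `|(EFin \o w) t| = 0)%E.
  apply/eqP; rewrite eq_le integral_ge0 ?andbT//.
  rewrite (eq_integral (fun t => - (w t)%:E)%E); last first.
    move=> t /set_mem /= wt; rewrite ltr0_norm//.
  rewrite (integralN (f := EFin \o w)); last exact: integrable_add_def.
  by rewrite leeNl oppe0.
have := (ae_eq_integral_abs P mD (measurable_int _ iwD)).1 a0.
apply: filterS => t /= wt; rewrite leNgt; apply/negP => wt0.
by have [] := wt wt0 => w0; rewrite w0 ltxx in wt0.
Qed.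

(** Since [w] is measurable for [G], the sets where it is negative or positive lie in [G]; the sign
    criterion applies to both [w] and [- w]. *)
Lemma ae_eq0_sub_sigma d (T : measurableType d) (R : realType)
    (P : probability T R) (G : set_system T) (w : T -> R) :
  sub_sigma_algebra_of G -> measurable_wrt G w ->
  P.-integrable setT (EFin \o w) ->
  (forall A, G A -> (\int[P]_(t in A) (w t)%:E = 0)%E) ->
  {ae P, forall t, w t = 0}.
Proof.
move=> sG mw iw w0.
have GI (I : interval R) : G (w @^-1` [set` I]).
  by apply: ((measurable_wrtP _ sG).1 mw); exists [set` I] => //; rewrite setTI.
have wp : {ae P, forall t, 0 <= w t}.
  apply: ae_ge0_integral_neg => //; rewrite w0//.
  by have := GI `]-oo, 0[; congr G; apply/seteqP; split=> t; rewrite /= in_itv.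
have wn : {ae P, forall t, 0 <= - w t}.
  apply: ae_ge0_integral_neg; first exact: (integrableN (f := EFin \o w)).
  rewrite (_ : [set t | - w t < 0] = w @^-1` [set` `]0, +oo[]); last first.
    by apply/seteqP; split=> t; rewrite /= in_itv/= andbT oppr_lt0.
  have GA := GI `]0, +oo[; have mA := sG.2 _ GA.
  have iwA : P.-integrable (w @^-1` [set` `]0, +oo[]) (EFin \o w).
    exact: integrableS iw.
  rewrite (integralN (f := EFin \o w)); last exact: integrable_add_def.
  by rewrite w0 ?oppe0.
by apply: filterS2 wp wn => t; rewrite oppr_ge0 => ? ?; apply/eqP; rewrite eq_le; apply/andP.
Qed.

(** * Conditional expectations and conditional probabilities *)

Lemma integral_eq_of_sub d (T : measurableType d) (R : realType)
    (P : probability T R) (f g : T -> R) :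
  P.-integrable setT (EFin \o f) -> P.-integrable setT (EFin \o g) ->
  (\int[P]_t (f t - g t)%:E = 0)%E ->
  (\int[P]_t (f t)%:E = \int[P]_t (g t)%:E)%E.
Proof.
move=> fi gi; rewrite (integralB_EFin measurableT fi gi).
have := integrable_fin_num measurableT fi.
have := integrable_fin_num measurableT gi => /=.
case: (integral _ _ _) => // x _; case: (integral _ _ _) => // y _.
by move=> /eqP; rewrite -EFinB eqe subr_eq0 => /eqP ->.
Qed.

Lemma cond_exp_mul d (T : measurableType d) (R : realType)
    (P : probability T R) (G : set_system T) (f W h : T -> R) :
  sub_sigma_algebra_of G -> is_cond_exp P G f W -> measurable_wrt G h ->
  P.-integrable setT (fun t => (f t * h t)%:E) ->
  P.-integrable setT (fun t => (W t * h t)%:E) ->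
  (\int[P]_t (f t * h t)%:E = \int[P]_t (W t * h t)%:E)%E.
Proof.
move=> sG [fi Wi WG fW] mh fh Wh.
have u0 : (\int[P]_t ((f t - W t) * h t)%:E = 0)%E.
  apply: (integral_mul_eq0 sG (u := fun t => f t - W t)) => //.
  - exact: (integrableB _ fi Wi).
  - move=> A GA; have mA := sG.2 _ GA.
    rewrite integralB_EFin//; [|exact: integrableS fi|exact: integrableS Wi].
    by rewrite fW// subee// integrable_fin_num//; exact: integrableS fi.
  - have := integrableB measurableT fh Wh.
    by congr (_.-integrable _ _); apply/funext => t /=; rewrite mulrBl.
apply: integral_eq_of_sub => //.
by rewrite -[RHS]u0; apply: eq_integral => t _; rewrite mulrBl.
Qed.

Lemma integrable_mul_bounded d (T : measurableType d) (R : realType)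
    (P : probability T R) (f h : T -> R) :
  P.-integrable setT (EFin \o f) -> measurable_fun setT h ->
  (forall t, 0 <= h t <= 1) -> P.-integrable setT (fun t => (f t * h t)%:E).
Proof.
move=> fi mh h01; have mf : measurable_fun setT f by exact/measurable_EFinP/(measurable_int P).
apply: le_integrable fi => //.
  exact/measurable_EFinP/measurable_funM.
move=> t _ /=; have /andP[h0 h1] := h01 t.
by rewrite lee_fin normrM ler_piMr// ger0_norm.
Qed.

(** The sets where [p] is negative or exceeds 1 lie in [G], and integrating over them shows that
    they are null, so truncating [p] to [0,1] gives another version. Bounded versions keep products
    with integrable functions integrable. *)
Lemma cond_prob_bounded d (T : measurableType d) (R : realType)
    (P : probability T R) (G : set_system T) (A : set T) (p : T -> R) :
  sub_sigma_algebra_of G -> measurable A -> is_cond_prob P G A p ->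
  exists p', [/\ is_cond_prob P G A p', forall t, 0 <= p' t <= 1
               & {ae P, forall t, p t = p' t}].
Proof.
move=> sG mA [Ai pi pG Ap].
have mp : measurable_wrt G p by exact/measurable_wrtP.
have GI (I : interval R) : G (p @^-1` [set` I]).
  by apply: pG; exists [set` I] => //; rewrite setTI.
have p0 : {ae P, forall t, 0 <= p t}.
  apply: ae_ge0_integral_neg => //; rewrite Ap; last first.
    by have := GI `]-oo, 0[; congr G; apply/seteqP; split=> t; rewrite /= in_itv.
  by apply: integral_ge0 => t _; rewrite lee_fin indicE.
have p1 : {ae P, forall t, 0 <= 1 - p t}.
  have ci : P.-integrable setT (EFin \o cst 1).
    exact: finite_measure_integrable_cst.
  have G1 : G [set t | 1 - p t < 0].
    have := GI `]1, +oo[; congr G; apply/seteqP.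
    by split=> t; rewrite /= in_itv/= andbT subr_lt0.
  have mG1 := sG.2 _ G1.
  apply: ae_ge0_integral_neg; first exact: (integrableB _ ci pi).
  rewrite integralB_EFin//; [|exact: integrableS ci|exact: integrableS pi].
  rewrite Ap// -integralB_EFin//; [|exact: integrableS ci|exact: integrableS Ai].
  apply: integral_ge0 => t _; rewrite -EFinB lee_fin subr_ge0 indicE.
  by case: (_ \in _).
pose p' t := Num.min (Num.max (p t) 0) 1.
have pp' : {ae P, forall t, p t = p' t}.
  apply: filterS2 p0 p1 => t; rewrite subr_ge0 /p' => h0 h1.
  by rewrite max_l// min_l.
have p'01 t : 0 <= p' t <= 1.
  by rewrite /p' le_min ler01 le_max lexx orbT ge_min lexx orbT.
have mp' : measurable_wrt G p'.
  apply: (@measurable_minr _ (g_sigma_algebraType G)) => //.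
  exact: (@measurable_funrpos _ (g_sigma_algebraType G)).
have mp1 := measurable_wrt_sub sG mp; have mp1' := measurable_wrt_sub sG mp'.
exists p'; split => //; split => //.
- have ci : P.-integrable setT (EFin \o cst (1 : R)).
    exact: finite_measure_integrable_cst.
  apply: le_integrable ci => //; first exact/measurable_EFinP.
  move=> t _ /=; rewrite lee_fin normr1.
  by have /andP[h0 h1] := p'01 t; rewrite ger0_norm.
- exact/(measurable_wrtP _ sG).
- move=> B GB; have mB := sG.2 _ GB; rewrite -Ap//.
  apply: ae_eq_integral => //.
  + by apply/measurable_EFinP; exact: measurable_funTS.
  + by apply/measurable_EFinP; exact: measurable_funTS.
  + by apply: filterS pp' => t -> _.
Qed.

Lemma cond_prob_unique d (T : measurableType d) (R : realType)
    (P : probability T R) (G : set_system T) (A : set T) (p q : T -> R) :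
  sub_sigma_algebra_of G -> is_cond_prob P G A p -> is_cond_prob P G A q ->
  {ae P, forall t, p t = q t}.
Proof.
move=> sG [Ai pi pG Ap] [_ qi qG Aq].
have : {ae P, forall t, p t - q t = 0}.
  apply: (ae_eq0_sub_sigma (w := fun t => p t - q t) sG).
  - by apply: (@measurable_funB _ (g_sigma_algebraType G));
      exact/(measurable_wrtP _ sG).
  - exact: (integrableB _ pi qi).
  - move=> B GB; have mB := sG.2 _ GB.
    rewrite integralB_EFin//; [|exact: integrableS pi|exact: integrableS qi].
    by rewrite Ap// Aq// subee// integrable_fin_num//; exact: integrableS Ai.
by apply: filterS => t /eqP; rewrite subr_eq0 => /eqP.
Qed.

Lemma cond_prob_setT d (T : measurableType d) (R : realType)
    (P : probability T R) (G : set_system T) :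
  sub_sigma_algebra_of G -> is_cond_prob P G setT (cst 1).
Proof.
move=> sG; have ci : P.-integrable setT (EFin \o cst (1 : R)).
  exact: finite_measure_integrable_cst.
split => //; first by rewrite indicT.
- by apply/(measurable_wrtP _ sG); exact: measurable_cst.
- by move=> A _; rewrite indicT.
Qed.

(** * Product formula under conditional independence *)

(** The product rule is applied to the family equal to [A] at [i], [B] at [j] and the whole space
    elsewhere; by uniqueness of versions the remaining factors are a.s. 1. *)
Lemma cond_indep_pair d (T : measurableType d) (R : realType)
    (P : probability T R) n (G : set_system T) (F : 'I_n -> set_system T)
    (i j : 'I_n) (A B : set T) :
  sub_sigma_algebra_of G -> (forall l, sub_sigma_algebra_of (F l)) ->
  cond_indep P G F -> i != j -> F i A -> F j B ->
  exists p q, [/\ is_cond_prob P G A p, is_cond_prob P G B q,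
    forall t, 0 <= p t <= 1, forall t, 0 <= q t <= 1
    & (\int[P]_t (p t * q t)%:E = \int[P]_t (\1_A t * \1_B t)%:E)%E].
Proof.
move=> sG sF ci ij FA FB.
pose C l := if l == i then A else if l == j then B else setT.
have FT l : F l setT.
  by have [[F0 FC _] _] := sF l; have := FC _ F0; rewrite setTD setC0.
have FCl l : F l (C l).
  by rewrite /C; case: eqP => [->//|_]; case: eqP => [->//|_].
have [p [pC [pi piP pG pE]]] := ci C FCl.
have mC l : measurable (C l) by apply: (sF l).2.
have Ci : C i = A by rewrite /C eqxx.
have Cj : C j = B by rewrite /C eq_sym (negbTE ij) eqxx.
have /choice[p' p'P] l := cond_prob_bounded sG (mC l) (pC l).
exists (p' i), (p' j).
have [Hi Bi aei] := p'P i; have [Hj Bj aej] := p'P j.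
rewrite -Ci -Cj; split => //.
have GT : G setT by case: sG => -[G0 GC _] _; have := GC _ G0; rewrite setTD setC0.
have mI l : measurable_fun setT (p' l).
  by have [[_ /(measurable_int P)/measurable_EFinP ? _ _] _ _] := p'P l.
have <- : (\int[P]_t (\prod_(l < n) p l t)%:E =
           \int[P]_t (\1_(C i) t * \1_(C j) t)%:E)%E.
  rewrite pE//; apply: eq_integral => t _.
  rewrite !indicE -natrM mulnb; congr (_%:R)%:E; congr nat_of_bool.
  apply/idP/andP => [/set_mem Ct|[/set_mem Cit /set_mem Cjt]].
    by split; apply/mem_set/Ct.
  apply/mem_set => l; rewrite /C; case: eqP => [_|_]; first by rewrite -Ci.
  by case: eqP => [_|_//]; rewrite -Cj.
apply/esym/ae_eq_integral => //.
- exact: measurable_int piP.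
- by apply/measurable_EFinP/measurable_funM.
have ae1 l : {ae P, forall t, l != i -> l != j -> p l t = 1}.
  have [->|li] := eqVneq l i; first by apply: aeW.
  have [->|lj] := eqVneq l j; first by apply: aeW.
  have := cond_prob_unique sG (pC l); rewrite {1}/C (negbTE li) (negbTE lj).
  by move=> /(_ _ (cond_prob_setT P sG)); apply: filterS => t ->.
have aeall : {ae P, forall t, forall l, l != i -> l != j -> p l t = 1}.
  exact: filter_forall.
apply: filterS3 aei aej aeall => t pit pjt pl _ /=.
rewrite (bigD1 i)//= (bigD1 j) 1?eq_sym//= big1 ?mulr1 ?pit ?pjt//.
by move=> l /andP[? ?]; exact: pl.
Qed.

(* With [q] a version of [P(B | G)], conditional independence of events says that
   [1_B - q] integrates to zero over every set of [F i], so
   [E[f 1_B] = E[f q] = E[Wf q] = E[Wf 1_B]]. Thus [f - Wf] integrates to zero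
   over every set of [F j], and [E[f g] = E[Wf g] = E[Wf Wg]]. *)
Lemma cond_indep_mul d (T : measurableType d) (R : realType)
    (P : probability T R) n (G : set_system T) (F : 'I_n -> set_system T)
    (i j : 'I_n) (f g Wf Wg : T -> R) :
  sub_sigma_algebra_of G -> (forall l, sub_sigma_algebra_of (F l)) ->
  cond_indep P G F -> i != j ->
  measurable_wrt (F i) f -> measurable_wrt (F j) g ->
  is_cond_exp P G f Wf -> is_cond_exp P G g Wg ->
  P.-integrable setT (fun t => (f t * g t)%:E) ->
  P.-integrable setT (fun t => (Wf t * g t)%:E) ->
  P.-integrable setT (fun t => (Wf t * Wg t)%:E) ->
  (\int[P]_t (f t * g t)%:E = \int[P]_t (Wf t * Wg t)%:E)%E.
Proof.
move=> sG sF ci ij mf mg Hf Hg fg Wfg Wfg'.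
have [fi Wfi WfG fWf] := Hf.
have mWf : measurable_wrt G Wf by exact/measurable_wrtP.
have fWfB B : F j B -> (\int[P]_(t in B) (f t)%:E = \int[P]_(t in B) (Wf t)%:E)%E.
  move=> FB; have mB := (sF j).2 _ FB.
  have FT : F i setT.
    by have [[F0 FC _] _] := sF i; have := FC _ F0; rewrite setTD setC0.
  (* Pairing [B] with the whole space fixes one version [q] before [A] varies; the version [q1]
     found below for each [A] agrees with it a.s. *)
  have [_ [q [_ Hq _ q01 _]]] := cond_indep_pair sG sF ci ij FT FB.
  have [Bi qi qG Bq] := Hq.
  have mq : measurable_wrt G q by exact/measurable_wrtP.
  have mq' := measurable_wrt_sub sG mq.
  have mB' : measurable_fun setT (\1_B : T -> R) by exact: measurable_indic.
  have B01 t : 0 <= (\1_B t : R) <= 1 by rewrite indicE; case: (_ \in _); rewrite !lexx ler01.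
  have step A : F i A -> (\int[P]_(t in A) (\1_B t)%:E = \int[P]_(t in A) (q t)%:E)%E.
    move=> FA; have mA := (sF i).2 _ FA.
    have [p [q1 [Hp Hq1 p01 q101 pq]]] := cond_indep_pair sG sF ci ij FA FB.
    have [Ai pi pG _] := Hp; have [_ q1i q1G _] := Hq1.
    have mp : measurable_fun setT p by exact/measurable_EFinP/(measurable_int P).
    have mq1 : measurable_fun setT q1 by exact/measurable_EFinP/(measurable_int P).
    rewrite [LHS]integral_indicr [RHS]integral_indicr.
    under eq_integral do rewrite mulrC; rewrite -pq.
    under [RHS]eq_integral do rewrite mulrC.
    rewrite (cond_exp_mul sG Hp mq) ?integrable_mul_bounded//.
    apply: ae_eq_integral => //.
    - by apply/measurable_EFinP/measurable_funM.
    - by apply/measurable_EFinP/measurable_funM.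
    by apply: filterS (cond_prob_unique sG Hq1 Hq) => t -> _.
  have uB : (\int[P]_t ((\1_B t - q t) * f t)%:E = 0)%E.
    apply: (integral_mul_eq0 (sF i) (u := fun t => \1_B t - q t)) => //.
    - exact: (integrableB _ Bi qi).
    - move=> A FA; have mA := (sF i).2 _ FA.
      rewrite integralB_EFin//; [|exact: integrableS Bi|exact: integrableS qi].
      by rewrite step// subee// integrable_fin_num//; exact: integrableS qi.
    - have := integrableB measurableT (integrable_mul_bounded fi mB' B01)
        (integrable_mul_bounded fi mq' q01).
      by congr (_.-integrable _ _); apply/funext => t; rewrite mulrBl ![_ * f t]mulrC.
  rewrite [LHS]integral_indicr [RHS]integral_indicr.
  transitivity (\int[P]_t (f t * q t)%:E)%E.
    apply: integral_eq_of_sub; try exact: integrable_mul_bounded.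
    by rewrite -[RHS]uB; apply: eq_integral => t _; rewrite -mulrBr mulrC.
  rewrite (cond_exp_mul sG Hf mq) ?integrable_mul_bounded//.
  under [LHS]eq_integral do rewrite mulrC.
  rewrite -(cond_exp_mul sG Hq mWf).
  - by under [LHS]eq_integral do rewrite mulrC.
  - have := integrable_mul_bounded Wfi mB' B01.
    by congr (_.-integrable _ _); apply/funext => t; rewrite mulrC.
  - have := integrable_mul_bounded Wfi mq' q01.
    by congr (_.-integrable _ _); apply/funext => t; rewrite mulrC.
transitivity (\int[P]_t (Wf t * g t)%:E)%E.
  have u0 : (\int[P]_t ((f t - Wf t) * g t)%:E = 0)%E.
    apply: (integral_mul_eq0 (sF j) (u := fun t => f t - Wf t)) => //.
    - exact: (integrableB _ fi Wfi).
    - move=> B FB; have mB := (sF j).2 _ FB.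
      rewrite integralB_EFin//; [|exact: integrableS fi|exact: integrableS Wfi].
      by rewrite fWfB// subee// integrable_fin_num//; exact: integrableS Wfi.
    - have := integrableB measurableT fg Wfg.
      by congr (_.-integrable _ _); apply/funext => t /=; rewrite mulrBl.
  apply: integral_eq_of_sub => //.
  by rewrite -[RHS]u0; apply: eq_integral => t _; rewrite -mulrBl.
under [LHS]eq_integral do rewrite mulrC.
rewrite (cond_exp_mul sG Hg mWf).
- by under [LHS]eq_integral do rewrite mulrC.
- by move: Wfg; congr (_.-integrable _ _); apply/funext => t; rewrite mulrC.
- by move: Wfg'; congr (_.-integrable _ _); apply/funext => t; rewrite mulrC.
Qed.

(** * Bilinearity and block decomposition of covariance matrices *)

(** Guards against the value 0 that [fine] gives to infinite expectations: under this condition the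
    entries of [covmx P A B] are genuine expectations. *)
Definition integrable_products d (T : measurableType d) (R : realType)
    (P : probability T R) m n (A : T -> 'cV[R]_m) (B : T -> 'cV[R]_n) :=
  forall i j, P.-integrable setT (fun t => (A t i 0 * B t j 0)%:E).

Lemma integrable_productsC d (T : measurableType d) (R : realType)
    (P : probability T R) m n (A : T -> 'cV[R]_m) (B : T -> 'cV[R]_n) :
  integrable_products P A B -> integrable_products P B A.
Proof.
by move=> AB i j; under eq_fun do rewrite mulrC; exact: AB.
Qed.

Lemma integrable_products_L2 d (T : measurableType d) (R : realType)
    (P : probability T R) m n (A : T -> 'cV[R]_m) (B : T -> 'cV[R]_n) :
  centered_L2_vec P A -> centered_L2_vec P B -> integrable_products P A B.
Proof.
move=> LA LB i j.
by have /Lfun1_integrable := Lfun2_mul_Lfun1 (LA i).1 (LB j).1.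
Qed.

Lemma mulmx_rvE (T : Type) (R : realType) m n p (A : T -> 'cV[R]_m)
    (B : T -> 'cV[R]_n) (M : 'M[R]_(p, m)) i j :
  (fun t => ((M *m A t) i 0 * B t j 0)%:E) =
  (fun t => \sum_(l < m) ((M i l)%:E * (A t l 0 * B t j 0)%:E))%E.
Proof.
apply/funext => t; rewrite mxE mulr_suml -sumEFin.
by apply: eq_bigr => l _; rewrite -mulrA EFinM.
Qed.

Lemma integrable_products_mull d (T : measurableType d) (R : realType)
    (P : probability T R) m n p (A : T -> 'cV[R]_m) (B : T -> 'cV[R]_n)
    (M : 'M[R]_(p, m)) :
  integrable_products P A B -> integrable_products P (fun t => M *m A t) B.
Proof.
move=> AB i j; rewrite mulmx_rvE.
by apply: integrable_sum => // l _; exact: integrableZl.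
Qed.

Lemma covmx_tr d (T : measurableType d) (R : realType)
    (P : probability T R) m n (A : T -> 'cV[R]_m) (B : T -> 'cV[R]_n) :
  (covmx P A B)^T = covmx P B A.
Proof.
apply/matrixP => i j; rewrite !mxE; congr (fine 'E_P[_])%E.
by apply/funext => t; rewrite mulrC.
Qed.

Lemma covmx_mull d (T : measurableType d) (R : realType)
    (P : probability T R) m n p (A : T -> 'cV[R]_m) (B : T -> 'cV[R]_n)
    (M : 'M[R]_(p, m)) :
  integrable_products P A B ->
  covmx P (fun t => M *m A t) B = M *m covmx P A B.
Proof.
move=> AB; apply/matrixP => i j; rewrite !mxE unlock mulmx_rvE.
rewrite integral_sum//; last by move=> l; exact: integrableZl.
rewrite -sum_fine; last first.
  by move=> l _; rewrite integralZl// fin_numM// integrable_fin_num.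
apply: eq_bigr => l _; rewrite integralZl// fineM ?integrable_fin_num//.
by rewrite mxE unlock.
Qed.

Lemma covmx_mulr d (T : measurableType d) (R : realType)
    (P : probability T R) m n p (A : T -> 'cV[R]_m) (B : T -> 'cV[R]_n)
    (M : 'M[R]_(p, n)) :
  integrable_products P A B ->
  covmx P A (fun t => M *m B t) = covmx P A B *m M^T.
Proof.
move=> /integrable_productsC BA.
by rewrite -covmx_tr covmx_mull// trmx_mul covmx_tr.
Qed.

Lemma covmx_col_mxl d (T : measurableType d) (R : realType)
    (P : probability T R) m1 m2 n (A1 : T -> 'cV[R]_m1) (A2 : T -> 'cV[R]_m2)
    (B : T -> 'cV[R]_n) :
  covmx P (fun t => col_mx (A1 t) (A2 t)) B =
  col_mx (covmx P A1 B) (covmx P A2 B).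
Proof.
apply/matrixP => i j; case: (splitP i) => l il.
  have -> : i = lshift m2 l by exact: val_inj.
  rewrite col_mxEu !mxE; congr (fine 'E_P[_])%E.
  by apply/funext => t; rewrite col_mxEu.
have -> : i = rshift m1 l by exact: val_inj.
rewrite col_mxEd !mxE; congr (fine 'E_P[_])%E.
by apply/funext => t; rewrite col_mxEd.
Qed.

Lemma covmx_col_mxr d (T : measurableType d) (R : realType)
    (P : probability T R) m n1 n2 (A : T -> 'cV[R]_m) (B1 : T -> 'cV[R]_n1)
    (B2 : T -> 'cV[R]_n2) :
  covmx P A (fun t => col_mx (B1 t) (B2 t)) =
  row_mx (covmx P A B1) (covmx P A B2).
Proof. by rewrite -covmx_tr covmx_col_mxl tr_col_mx !covmx_tr. Qed.

Lemma integrable_products_col_mxl d (T : measurableType d) (R : realType)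
    (P : probability T R) m1 m2 n (A1 : T -> 'cV[R]_m1) (A2 : T -> 'cV[R]_m2)
    (B : T -> 'cV[R]_n) :
  integrable_products P A1 B -> integrable_products P A2 B ->
  integrable_products P (fun t => col_mx (A1 t) (A2 t)) B.
Proof.
move=> h1 h2 i j; case: (splitP i) => l il.
  have -> : i = lshift m2 l by exact: val_inj.
  by under eq_fun do rewrite col_mxEu; exact: h1.
have -> : i = rshift m1 l by exact: val_inj.
by under eq_fun do rewrite col_mxEd; exact: h2.
Qed.

(** * Generated sigma-algebras, and covariances under conditioning *)

Lemma measurable_wrt_sigma_vec d (T : measurableType d) (R : realType) n
    (X : T -> 'cV[R]_n) i :
  measurable_wrt (sigma_vec X) (fun t => X t i 0).
Proof.
(* Two generations are unwound: the one in [measurable_wrt], then the one defining [sigma_vec] from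
   the preimages of the coordinates. *)
move=> _ B mB; apply: sub_sigma_algebra; apply: sub_sigma_algebra.
by rewrite (bigD1 i)//=; left; exists B.
Qed.

Lemma sub_sigma_vec d (T : measurableType d) (R : realType) n
    (X : T -> 'cV[R]_n) :
  (forall i, measurable_fun setT (fun t => X t i 0)) ->
  sub_sigma_algebra_of (sigma_vec X).
Proof.
move=> mX; split; first exact: smallest_sigma_algebra.
apply: smallest_sub; first exact: sigma_algebra_measurable.
apply: (big_ind (fun F : set_system T => F `<=` measurable)) => //.
  by move=> F F' mF mF'; rewrite subUset.
by move=> i _ _ [B mB <-]; exact: (mX i measurableT).
Qed.

Lemma measurable_wrt_sigma_rv d (T : measurableType d) (R : realType)
    (f : T -> R) :
  measurable_wrt (sigma_rv f) f.
Proof. by move=> _ B mB; apply: sub_sigma_algebra; exists B. Qed.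

Lemma sub_sigma_rv d (T : measurableType d) (R : realType) (f : T -> R) :
  measurable_fun setT f -> sub_sigma_algebra_of (sigma_rv f).
Proof.
move=> mf; split.
  exact/sigma_algebra_preimage/sigma_algebra_measurable.
by move=> A [B mB <-]; exact: mf.
Qed.

(** Tower property, entry by entry: [A] may be replaced by its conditional expectation against the
    [G]-measurable [B]. It is used with [B = H]. *)
Lemma covmx_cond_exp d (T : measurableType d) (R : realType)
    (P : probability T R) (k m n : nat) (H : T -> 'cV[R]_k) (A : T -> 'cV[R]_m)
    (B : T -> 'cV[R]_n) (G : set_system T) (M : 'M[R]_(m, k)) :
  sub_sigma_algebra_of G -> (forall j, measurable_wrt G (fun t => B t j 0)) ->
  is_cond_exp_vec P G A (fun t => M *m H t) ->
  integrable_products P A B -> integrable_products P H B ->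
  covmx P A B = M *m covmx P H B.
Proof.
move=> sG mB AM AB HB; rewrite -covmx_mull//.
apply/matrixP => i j; rewrite !mxE unlock; congr fine.
apply: (cond_exp_mul sG (AM i) (mB j)) => //.
exact: integrable_products_mull.
Qed.

Lemma covmx_cond_indep d (T : measurableType d) (R : realType)
    (P : probability T R) (k m n l : nat) (H : T -> 'cV[R]_k)
    (A : T -> 'cV[R]_m) (B : T -> 'cV[R]_n) (G : set_system T)
    (F : 'I_l -> set_system T) (i j : 'I_l)
    (M : 'M[R]_(m, k)) (N : 'M[R]_(n, k)) :
  sub_sigma_algebra_of G -> (forall s, sub_sigma_algebra_of (F s)) ->
  cond_indep P G F -> i != j ->
  (forall a, measurable_wrt (F i) (fun t => A t a 0)) ->
  (forall b, measurable_wrt (F j) (fun t => B t b 0)) ->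
  is_cond_exp_vec P G A (fun t => M *m H t) ->
  is_cond_exp_vec P G B (fun t => N *m H t) ->
  integrable_products P A B -> integrable_products P H B ->
  integrable_products P H H ->
  covmx P A B = M *m covmx P H H *m N^T.
Proof.
move=> sG sF ci ij mA mB AM BN AB HB HH.
have HNH : integrable_products P H (fun t => N *m H t).
  exact/integrable_productsC/integrable_products_mull.
rewrite -mulmxA -covmx_mulr// -covmx_mull//.
apply/matrixP => a b; rewrite !mxE unlock; congr fine.
apply: (cond_indep_mul sG sF ci ij (mA a) (mB b) (AM a) (BN b)) => //.
  exact: integrable_products_mull.
exact: integrable_products_mull.
Qed.

(** * Square roots, column spaces and singular value decompositions *)

Lemma spd_sqrt_unit (R : realType) n (A Q : 'M[R]_n) :
  spd_sqrt A Q -> Q \in unitmx.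
Proof.
move=> [QT Qpos _]; rewrite -row_free_unit -kermx_eq0.
apply/rowV0P => v /sub_kermxP vQ; apply/eqP/negPn/negP => v0.
have /Qpos : v^T != 0 by apply: contraNneq v0 => vT; rewrite -[v]trmxK vT trmx0.
by rewrite trmxK vQ mul0mx mxE ltxx.
Qed.

(** The form at [v] is the squared Euclidean norm of [Q *m v], and [Q] is invertible. *)
Lemma spd_sqrt_form_gt0 (R : realType) n (A Q : 'M[R]_n) (v : 'cV[R]_n) :
  spd_sqrt A Q -> v != 0 -> 0 < (v^T *m A *m v) 0 0.
Proof.
move=> sQ v0; have [QT _ <-] := sQ.
have Qv0 : Q *m v != 0.
  by apply: contraNneq v0 => Qv; rewrite -[v](mulKmx (spd_sqrt_unit sQ)) Qv mulmx0.
rewrite -[v^T *m _ *m v]mulmxA -mulmxA mulmxA -[v^T *m Q]trmxK trmx_mul QT trmxK.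
set w := Q *m v in Qv0 *.
rewrite !mxE; under eq_bigr do rewrite mxE -expr2.
rewrite lt_def sumr_ge0 ?andbT; last by move=> i _; exact: sqr_ge0.
apply: contra Qv0; rewrite psumr_eq0; last by move=> i _; exact: sqr_ge0.
move=> /allP w0; apply/eqP/matrixP => i j; rewrite ord1 [RHS]mxE.
by have := w0 i (mem_index_enum i); rewrite /= sqrf_eq0 => /eqP.
Qed.

Lemma orthogonal_mx_unit (R : realType) n (S : 'M[R]_n) :
  orthogonal_mx S -> S \in unitmx.
Proof. by move=> /mulmx1_unit[]. Qed.

Lemma same_col_spaceP (R : realType) m n p (A : 'M[R]_(m, n))
    (B : 'M[R]_(m, p)) (C : 'M[R]_(n, p)) (r : nat) :
  B = A *m C -> \rank A = r -> \rank B = r -> same_col_space B A.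
Proof.
move=> BAC rA rB; apply/eqmxP; rewrite -(geq_leqif (mxrank_leqif_eq _)).
  by rewrite !mxrank_tr rA rB.
by rewrite BAC trmx_mul submxMl.
Qed.

(** Both column spaces lie in the kernel of [M^T], and the rank condition makes each of them the
    whole kernel. *)
Lemma same_col_space_ker (R : realType) m k n p (M : 'M[R]_(m, k))
    (A : 'M[R]_(m, n)) (B : 'M[R]_(m, p)) :
  M^T *m A = 0 -> M^T *m B = 0 ->
  \rank A = (m - \rank M)%N -> \rank B = (m - \rank M)%N ->
  same_col_space A B.
Proof.
have sub q (C : 'M[R]_(m, q)) : M^T *m C = 0 ->
    \rank C = (m - \rank M)%N -> (C^T :=: kermx M)%MS.
  move=> MC rC; apply/eqmxP; rewrite -(geq_leqif (mxrank_leqif_eq _)).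
    by rewrite mxrank_tr mxrank_ker rC.
  by apply/sub_kermxP; rewrite -[C^T *m M]trmxK trmx_mul trmxK MC trmx0.
move=> MA MB rA rB; rewrite /same_col_space.
exact: eqmx_trans (sub _ _ MA rA) (eqmx_sym (sub _ _ MB rB)).
Qed.

(** A diagonal matrix of size [k] by [k + l] has its last [l] columns zero, so the trailing right
    singular vectors are killed whatever the singular values are. *)
Lemma full_svd_rsub_eq0 (R : realType) k l (A : 'M[R]_(k, k + l)) S D T :
  full_svd A S D T -> A *m rsubmx T = 0.
Proof.
move=> [-> [_ oT] D0 _ _].
have -> : S *m D *m T^T *m rsubmx T = S *m rsubmx D.
  by rewrite !mulmx_rsub -!mulmxA (oT : T^T *m T = 1%:M) mulmx1.
have -> : rsubmx D = 0; last by rewrite mulmx0.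
apply/matrixP => i j; rewrite !mxE D0//= => ij.
by have := ltn_ord i; rewrite ij ltnNge leq_addr.
Qed.

Lemma full_svd_tr_rsub_eq0 (R : realType) k l (A : 'M[R]_(k + l, k)) S D T :
  full_svd A S D T -> (rsubmx S)^T *m A = 0.
Proof.
move=> [-> [oS _] D0 _ _].
rewrite trmx_rsub !mulmxA.
have -> : dsubmx S^T *m S *m D = dsubmx D.
  by rewrite mul_dsub_mx (oS : S^T *m S = 1%:M) mul_dsub_mx mul1mx.
have -> : dsubmx D = 0; last by rewrite mul0mx.
apply/matrixP => i j; rewrite !mxE D0//= => ij.
by have := ltn_ord j; rewrite -ij ltnNge leq_addr.
Qed.

(** Thin form of the decomposition: the last [l] rows of [D] vanish, so only the first [k] left
    singular vectors contribute. *)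
Lemma full_svd_lsubE (R : realType) k l (A : 'M[R]_(k + l, k)) S D T :
  full_svd A S D T -> A = lsubmx S *m (usubmx D *m T^T).
Proof.
move=> [-> _ D0 _ _].
rewrite -[in LHS](hsubmxK S) -[in LHS](vsubmxK D) mul_row_col.
have -> : dsubmx D = 0.
  apply/matrixP => i j; rewrite !mxE D0//= => ij.
  by have := ltn_ord j; rewrite -ij ltnNge leq_addr.
by rewrite mulmx0 addr0 mulmxA.
Qed.

(** The two ranks are at most [k] and [l], while their sum is at least the rank [k + l] of [S]. *)
Lemma rank_submx_unit (R : realType) k l (S : 'M[R]_(k + l)) :
  S \in unitmx -> \rank (lsubmx S) = k /\ \rank (rsubmx S) = l.
Proof.
move=> uS.
have kl : \rank S = (k + l)%N by exact: mxrank_unit.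
have := mxrank_adds_leqif (lsubmx S)^T (rsubmx S)^T.
move=> [+ _]; rewrite !mxrank_tr.
have -> : \rank ((lsubmx S)^T + (rsubmx S)^T)%MS = (k + l)%N.
  by rewrite addsmxE -tr_row_mx hsubmxK mxrank_tr.
have := rank_leq_col (lsubmx S); have := rank_leq_col (rsubmx S).
lia.
Qed.

(** * Mean square error and the normal equations *)

Definition col_rv (T : Type) (R : realType) (Y : T -> R) : T -> 'cV[R]_1 :=
  fun t => \col_(_ < 1) Y t.

(** The residual is the single entry of [r *m V], with [V = (Y; Z)] and [r = (1, -v^T)], so its
    second moment expands by bilinearity of [covmx]. *)
Lemma mean_square_error d (T : measurableType d) (R : realType)
    (P : probability T R) n (Y : T -> R) (Z : T -> 'cV[R]_n) (v : 'cV[R]_n) :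
  integrable_products P (col_rv Y) (col_rv Y) ->
  integrable_products P (col_rv Y) Z -> integrable_products P Z Z ->
  ('E_P[fun t => ((Y t - (v^T *m Z t) 0 0) ^+ 2)%R] =
   ((covmx P (col_rv Y) (col_rv Y) - v^T *m covmx P Z (col_rv Y)
     - (v^T *m covmx P Z (col_rv Y))^T + v^T *m covmx P Z Z *m v) 0 0)%:E)%E.
Proof.
move=> YY YZ ZZ; have ZY := integrable_productsC YZ.
pose V t := col_mx (col_rv Y t) (Z t).
pose r : 'rV[R]_(1 + n) := row_mx 1%:M (- v^T).
have VV : integrable_products P V V.
  have VY : integrable_products P V (col_rv Y) by exact: integrable_products_col_mxl.
  have VZ : integrable_products P V Z by exact: integrable_products_col_mxl.
  by apply: integrable_products_col_mxl; exact: integrable_productsC.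
have rV := integrable_products_mull r VV.
have rr := integrable_products_mull r (integrable_productsC rV).
have -> : (fun t => ((Y t - (v^T *m Z t) 0 0) ^+ 2)%R) =
          (fun t => (r *m V t) 0 0 * (r *m V t) 0 0).
  apply/funext => t; rewrite expr2.
  have -> : (r *m V t) 0 0 = Y t - (v^T *m Z t) 0 0; last by [].
  by rewrite mul_row_col mul1mx mulNmx !mxE.
have -> : covmx P (col_rv Y) (col_rv Y) - v^T *m covmx P Z (col_rv Y)
     - (v^T *m covmx P Z (col_rv Y))^T + v^T *m covmx P Z Z *m v
   = covmx P (fun t => r *m V t) (fun t => r *m V t).
  rewrite covmx_mull; last exact: integrable_productsC.
  rewrite covmx_mulr// !covmx_col_mxl !covmx_col_mxr tr_row_mx.
  rewrite -[col_mx (row_mx _ _) _]/(block_mx _ _ _ _) mulmxA mul_row_block mul_row_col.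
  rewrite !mul1mx !mulNmx !linearN /= !trmxK trmx1 !mulmx1 trmx_mul covmx_tr trmxK.
  by rewrite mulmxBl opprB addrA addrAC.
by rewrite mxE fineK// unlock; apply: integrable_fin_num => //; exact: rr.
Qed.

(** Completing the square at a solution [w] of the normal equations: the error at [v] is a constant
    plus the covariance form of [Z] at [v - w], which is positive unless [v = w]. *)
Lemma optimal_linear_predictor_unique d (T : measurableType d) (R : realType)
    (P : probability T R) n (Y : T -> R) (Z : T -> 'cV[R]_n) (w : 'cV[R]_n) :
  integrable_products P (col_rv Y) (col_rv Y) ->
  integrable_products P (col_rv Y) Z -> integrable_products P Z Z ->
  (forall v : 'cV[R]_n, v != 0 -> 0 < (v^T *m covmx P Z Z *m v) 0 0) ->
  covmx P Z Z *m w = covmx P Z (col_rv Y) ->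
  unique (optimal_linear_predictor P Y Z) (fun t => (w^T *m Z t) 0 0).
Proof.
move=> YY YZ ZZ Zpos wE.
have mse v : ('E_P[fun t => ((Y t - (v^T *m Z t) 0 0) ^+ 2)%R] =
    ((covmx P (col_rv Y) (col_rv Y) - w^T *m covmx P Z Z *m w) 0 0
     + ((v - w)^T *m covmx P Z Z *m (v - w)) 0 0)%:E)%E.
  rewrite mean_square_error//; congr EFin.
  have ST : (covmx P Z Z)^T = covmx P Z Z by exact: covmx_tr.
  rewrite -wE; move: (covmx P Z Z) (covmx P (col_rv Y) _) ST => S K ST.
  have -> : (v - w)^T = v^T - w^T by rewrite linearB.
  rewrite !trmx_mul trmxK ST !mulmxBl !mulmxBr !mulmxA.
  move: (v^T *m S *m w) (w^T *m S *m v) (v^T *m S *m v) (w^T *m S *m w).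
  by move=> ? ? ? ?; rewrite !mxE; lra.
split.
  exists w; split=> // v; rewrite !mse lee_fin lerD2l subrr mulmx0 mxE.
  have [->|vw] := eqVneq v w; first by rewrite subrr mulmx0 mxE.
  by apply: ltW; apply: Zpos; rewrite subr_eq0.
move=> W [v [-> vopt]]; have [->//|vw] := eqVneq v w.
have := vopt w; rewrite !mse lee_fin lerD2l subrr mulmx0 [leRHS]mxE leNgt.
by rewrite Zpos// subr_eq0.
Qed.

(** * Trailing canonical directions, and the effect of a left factor on column space and rank *)

(** The trailing right singular vectors are killed by the whitened covariance; its right factor
    [invmx QB] is absorbed into [V], and its left factor is cancelled by [QA]. *)
Lemma canonical_directions_rsub d (T : measurableType d) (R : realType)
    (P : probability T R) k l (A : T -> 'cV[R]_k) (B : T -> 'cV[R]_(k + l))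
    (U : 'M[R]_k) (V : 'M[R]_(k + l)) :
  canonical_directions P A B U V -> covmx P A B *m rsubmx V = 0.
Proof.
move=> [QA [QB [S [D [S' [sA sB svd _ ->]]]]]].
have /(congr1 (mulmx QA)) := full_svd_rsub_eq0 svd.
by rewrite -mulmx_rsub mulmx0 !mulmxA mulmxV ?mul1mx// (spd_sqrt_unit sA).
Qed.

Lemma same_col_space_mull (R : realType) q m n p (N : 'M[R]_(q, m))
    (A : 'M[R]_(m, n)) (B : 'M[R]_(m, p)) :
  same_col_space A B -> same_col_space (N *m A) (N *m B).
Proof. by move=> AB; rewrite /same_col_space !trmx_mul; exact: eqmxMr. Qed.

Lemma rank_mull_unit (R : realType) m n (N : 'M[R]_m) (A : 'M[R]_(m, n)) :
  N \in unitmx -> \rank (N *m A) = \rank A.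
Proof. by move=> uN; rewrite eqmxMfull ?row_full_unit. Qed.

Theorem mainTheorem1
  (R : realType) (d : measure_display) (T : measurableType d)
  (P : probability T R) (k : nat)
  (H X1 X2 X3 : T -> 'cV[R]_k) (Y : T -> R)
  (M1 M2 M3 : 'M[R]_k) (MY : 'rV[R]_k)
  (H_L2 : centered_L2_vec P H)
  (X1_L2 : centered_L2_vec P X1)
  (X2_L2 : centered_L2_vec P X2)
  (X3_L2 : centered_L2_vec P X3)
  (Y_L2 : centered_L2 P Y)
  (covHH : covmx P H H = 1%:M)
  (condInd : cond_indep P (sigma_vec H)
     (tnth [tuple sigma_rv Y; sigma_vec X1; sigma_vec X2; sigma_vec X3]))
  (lin1 : is_cond_exp_vec P (sigma_vec H) X1 (fun t => M1 *m H t))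
  (lin2 : is_cond_exp_vec P (sigma_vec H) X2 (fun t => M2 *m H t))
  (lin3 : is_cond_exp_vec P (sigma_vec H) X3 (fun t => M3 *m H t))
  (linY : is_cond_exp P (sigma_vec H) Y (fun t => (MY *m H t) 0 0))
  (rank1 : \rank M1 = k) (rank2 : \rank M2 = k) (rank3 : \rank M3 = k)
  (X : T -> 'cV[R]_(k + (k + k)))
  (X_def : X = fun t => col_mx (X1 t) (col_mx (X2 t) (X3 t)))
  (covXX : covmx P X X \in unitmx)
  (Q : 'M[R]_(k + (k + k)))
  (Q_sqrt : spd_sqrt (covmx P X X) Q)
  (* CCA between X and H *)
  (P0 : 'M[R]_(k + (k + k))) (D : 'M[R]_(k + (k + k), k)) (V0 : 'M[R]_k)
  (svd0 : full_svd (covmx P (fun t => invmx Q *m X t) H) P0 D V0)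
  (U1 : 'M[R]_(k + (k + k), k)) (U2 : 'M[R]_(k + (k + k), k + k))
  (U1_def : U1 = invmx Q *m lsubmx P0)
  (U2_def : U2 = invmx Q *m rsubmx P0)
  (* CCA between X1 and (X2; X3) *)
  (C1 : 'M[R]_k) (C23 : 'M[R]_(k + k))
  (cca1 : canonical_directions P X1 (fun t => col_mx (X2 t) (X3 t)) C1 C23)
  (* CCA between X3 and (X1; X2) *)
  (C3 : 'M[R]_k) (C12 : 'M[R]_(k + k))
  (cca2 : canonical_directions P X3 (fun t => col_mx (X1 t) (X2 t)) C3 C12)
  (R1 R2 : 'M[R]_(k + k, k))
  (R1_def : R1 = rsubmx C23)
  (R2_def : R2 = rsubmx C12)
  (RR : 'M[R]_(k + (k + k), k + k))
  (RR_def : RR = col_mx (row_mx 0 (usubmx R2))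
                 (col_mx (row_mx (usubmx R1) (dsubmx R2))
                         (row_mx (dsubmx R1) 0)))
  (rankRR : \rank RR = (k + k)%N)
  (Pt2 : 'M[R]_(k + (k + k), k + k))
  (Pt2_def : Pt2 = Q *m RR)
  (Pt1 : 'M[R]_(k + (k + k), k))
  (Pt1_basis : basis_of_orth_compl Pt2 Pt1)
  (Ut1 : 'M[R]_(k + (k + k), k))
  (Ut1_def : Ut1 = invmx Q *m Pt1) :
  (same_col_space RR U2 /\ same_col_space Ut1 U1) /\
  (exists Yhat : T -> R,
     unique (optimal_linear_predictor P Y (fun t => Ut1^T *m X t)) Yhat /\
     unique (optimal_linear_predictor P Y X) Yhat).

Proof.

(* Integrability and measurability of the data *)
have iHH := integrable_products_L2 H_L2 H_L2.
have YL2 : centered_L2_vec P (col_rv Y).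
  move=> i; rewrite (_ : (fun t => _) = Y)//.
  by apply/funext => t; rewrite mxE.
have linY' : is_cond_exp_vec P (sigma_vec H) (col_rv Y) (fun t => MY *m H t).
  move=> i; rewrite ord1 (_ : (fun t => col_rv Y t 0 0) = Y)//.
  by apply/funext => t; rewrite mxE.
have mL2 n (Z : T -> 'cV[R]_n) : centered_L2_vec P Z -> forall i,
    measurable_fun setT (fun t => Z t i 0).
  by move=> ZL2 i; have [+ _] := ZL2 i; rewrite inE => /andP[] /[!inE].
have sH : sub_sigma_algebra_of (sigma_vec H) by apply/sub_sigma_vec/mL2.
have mH := measurable_wrt_sigma_vec (X := H).
pose F := tnth [tuple sigma_rv Y; sigma_vec X1; sigma_vec X2; sigma_vec X3].
have sF s : sub_sigma_algebra_of (F s).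
  case: s => [[|[|[|[|//]]]] hs]; rewrite /F /tnth /=.
  - by apply: sub_sigma_rv; have [+ _] := Y_L2; rewrite inE => /andP[] /[!inE].
  - exact/sub_sigma_vec/mL2.
  - exact/sub_sigma_vec/mL2.
  - exact/sub_sigma_vec/mL2.
(* Positions in the tuple of [condInd]: [Y] at [i0], then the three views. *)
pose i0 := @Ordinal 4 0 isT; pose i1 := @Ordinal 4 1 isT.
pose i2 := @Ordinal 4 2 isT; pose i3 := @Ordinal 4 3 isT.
have mY a : measurable_wrt (F i0) (fun t => col_rv Y t a 0).
  rewrite (_ : (fun t => _) = Y); first exact: measurable_wrt_sigma_rv.
  by apply/funext => t; rewrite mxE.
have mX1 : forall a, measurable_wrt (F i1) (fun t => X1 t a 0).
  exact: measurable_wrt_sigma_vec.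
have mX2 : forall a, measurable_wrt (F i2) (fun t => X2 t a 0).
  exact: measurable_wrt_sigma_vec.
have mX3 : forall a, measurable_wrt (F i3) (fun t => X3 t a 0).
  exact: measurable_wrt_sigma_vec.
have cov (m n : nat) (A : T -> 'cV[R]_m) (B : T -> 'cV[R]_n) i j M N :
    centered_L2_vec P A -> centered_L2_vec P B ->
    (forall a, measurable_wrt (F i) (fun t => A t a 0)) ->
    (forall a, measurable_wrt (F j) (fun t => B t a 0)) ->
    is_cond_exp_vec P (sigma_vec H) A (fun t => M *m H t) ->
    is_cond_exp_vec P (sigma_vec H) B (fun t => N *m H t) ->
    i != j -> covmx P A B = M *m N^T.
  move=> LA LB mA mB AM BN ij.
  rewrite (covmx_cond_indep sH sF condInd ij mA mB AM BN) ?covHH ?mulmx1//;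
    exact: integrable_products_L2.
pose M := col_mx M1 (col_mx M2 M3).
have XL2 : centered_L2_vec P X.
  move=> i; rewrite X_def; case: (splitP i) => l il.
    have -> : i = lshift (k + k) l by exact: val_inj.
    by under eq_fun do rewrite col_mxEu; exact: X1_L2.
  have -> : i = rshift k l by exact: val_inj.
  under eq_fun do rewrite col_mxEd; case: (splitP l) => s ls.
    have -> : l = lshift k s by exact: val_inj.
    by under eq_fun do rewrite col_mxEu; exact: X2_L2.
  have -> : l = rshift k s by exact: val_inj.
  by under eq_fun do rewrite col_mxEd; exact: X3_L2.
have iXX := integrable_products_L2 XL2 XL2.
have iXH := integrable_products_L2 XL2 H_L2.
have iXY := integrable_products_L2 XL2 YL2.
have iYY := integrable_products_L2 YL2 YL2.

(* Cross-covariances and the relation [M^T *m RR = 0] *)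
have covXH : covmx P X H = M.
  have covAH (A : T -> 'cV[R]_k) N : centered_L2_vec P A ->
      is_cond_exp_vec P (sigma_vec H) A (fun t => N *m H t) -> covmx P A H = N.
    move=> LA AN; rewrite (covmx_cond_exp sH mH AN) ?covHH ?mulmx1//;
      exact: integrable_products_L2.
  by rewrite X_def !covmx_col_mxl (covAH _ M1)// (covAH _ M2)// (covAH _ M3).
have covXY : covmx P X (col_rv Y) = M *m MY^T.
  rewrite X_def !covmx_col_mxl /M !mul_col_mx.
  rewrite (cov _ _ _ _ i1 i0 M1 MY)// (cov _ _ _ _ i2 i0 M2 MY)//.
  by rewrite (cov _ _ _ _ i3 i0 M3 MY).
have cov12 : covmx P X1 X2 = M1 *m M2^T by exact: (cov _ _ _ _ i1 i2).
have cov13 : covmx P X1 X3 = M1 *m M3^T by exact: (cov _ _ _ _ i1 i3).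
have cov31 : covmx P X3 X1 = M3 *m M1^T by exact: (cov _ _ _ _ i3 i1).
have cov32 : covmx P X3 X2 = M3 *m M2^T by exact: (cov _ _ _ _ i3 i2).
have uM1 : M1 \in unitmx by rewrite -row_free_unit /row_free rank1.
have uM3 : M3 \in unitmx by rewrite -row_free_unit /row_free rank3.
(* The covariance of [X1] with [(X2; X3)] is [M1] times [(M2^T, M3^T)], and the invertible [M1] is
   cancelled. *)
have R1E : M2^T *m usubmx R1 + M3^T *m dsubmx R1 = 0.
  have := canonical_directions_rsub cca1.
  rewrite covmx_col_mxr cov12 cov13 -R1_def -mul_mx_row -{1}[R1]vsubmxK -mulmxA.
  by move=> /(congr1 (mulmx (invmx M1))); rewrite mulKmx// mulmx0 mul_row_col.
have R2E : M1^T *m usubmx R2 + M2^T *m dsubmx R2 = 0.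
  have := canonical_directions_rsub cca2.
  rewrite covmx_col_mxr cov31 cov32 -R2_def -mul_mx_row -{1}[R2]vsubmxK -mulmxA.
  by move=> /(congr1 (mulmx (invmx M3))); rewrite mulKmx// mulmx0 mul_row_col.
(* The zero blocks pad [R1] at [X1] and [R2] at [X3], so the two block columns of the product are
   exactly [R1E] and [R2E]. *)
have MRR : M^T *m RR = 0.
  rewrite RR_def /M !tr_col_mx !mul_row_col !mul_mx_row !mulmx0 !add_row_mx.
  by rewrite addr0 add0r R1E R2E row_mx0.
have rM : \rank M = k.
  apply/eqP; rewrite eqn_leq rank_leq_col/= -{1}rank1.
  by rewrite -(addsmxE M1) mxrankS// addsmxSl.

(* Equality of the column spaces in claim (i) *)
have uQ := spd_sqrt_unit Q_sqrt; have [QT _ QQ] := Q_sqrt.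
have uQV : invmx Q \in unitmx by rewrite unitmx_inv.
have QVT : (invmx Q)^T = invmx Q by rewrite trmx_inv QT.
move: svd0; rewrite covmx_mull// covXH => svd.
have uP0 : P0 \in unitmx by case: svd => _ [/orthogonal_mx_unit].
have [rP1 rP2] := rank_submx_unit uP0.
have MU2 : M^T *m U2 = 0.
  have /(congr1 trmx) := full_svd_tr_rsub_eq0 svd.
  by rewrite !trmx_mul trmxK QVT trmx0 -mulmxA -U2_def.
have rk : (k + (k + k) - k)%N = (k + k)%N by rewrite addKn.
have spanU2 : same_col_space RR U2.
  apply: (same_col_space_ker MRR MU2); rewrite rM rk//.
  by rewrite U2_def rank_mull_unit.
have RRM : RR^T *m M = 0 by rewrite -[M]trmxK -trmx_mul MRR trmx0.
have [fPt1 oPt1] := Pt1_basis.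
have rPt1 : \rank Pt1 = k by rewrite -mxrank_tr; exact/eqP.
(* As [Q] is symmetric, this is the orthogonality of the columns of [Pt1] to those of
   [Pt2 = Q *m RR], read entry by entry. *)
have RRQPt1 : RR^T *m (Q *m Pt1) = 0.
  apply/matrixP => i j.
  have /oPt1/(_ (col i Pt2)) : ((col j Pt1)^T <= Pt1^T)%MS.
    by rewrite tr_col row_sub.
  rewrite tr_col row_sub => /(_ isT)/matrixP/(_ 0 0).
  rewrite mulmxA -QT -trmx_mul -Pt2_def !mxE => colij; rewrite -[RHS]colij.
  by apply: eq_bigr => l _; rewrite !mxE.
(* Both matrices have rank [k], the dimension [3k - 2k] of the kernel of [RR^T]. *)
have spanQPt1 : same_col_space (Q *m Pt1) M.
  apply: (same_col_space_ker RRQPt1 RRM); rewrite rankRR.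
    by rewrite rank_mull_unit// rPt1 addnK.
  by rewrite rM addnK.
have spanM : same_col_space M (Q *m lsubmx P0).
  have ME : M = (Q *m lsubmx P0) *m (usubmx D *m V0^T).
    by rewrite -mulmxA -(full_svd_lsubE svd) mulKVmx.
  by apply: (same_col_spaceP ME) rM; rewrite rank_mull_unit.
(* [N] is the inverse of [covmx P X X]; applying it to [Q *m Pt1] and [Q *m lsubmx P0] yields [Ut1]
   and [U1]. *)
pose N := invmx Q *m invmx Q.
have Ut1E : Ut1 = N *m (Q *m Pt1) by rewrite Ut1_def /N -mulmxA mulKmx.
have U1E : U1 = N *m (Q *m lsubmx P0) by rewrite U1_def /N -mulmxA mulKmx.
split.
  split=> //; rewrite Ut1E U1E; apply: same_col_space_mull.
  exact: eqmx_trans spanQPt1 spanM.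

(* Equality of the optimal predictors in claim (ii) *)
have /submxP[c0 c0E] : ((N *m M)^T <= Ut1^T)%MS.
  by rewrite Ut1E (same_col_space_mull N spanQPt1).
have NME : N *m M = Ut1 *m c0^T by rewrite -[LHS]trmxK c0E trmx_mul trmxK.
have covN : covmx P X X *m N = 1%:M.
  by rewrite -QQ /N mulmxA mulmxK// mulmxV.
(* By [NME], [w] equals [N *m M *m MY^T], the solution of the normal equations for [X]; its
   factorization through [Ut1] makes [c] a weight vector for the feature. *)
pose c := c0^T *m MY^T; pose w := Ut1 *m c.
have wE : covmx P X X *m w = covmx P X (col_rv Y).
  by rewrite /w /c (mulmxA Ut1) -NME -(mulmxA N) (mulmxA _ N) covN mul1mx covXY.
have iYX := integrable_productsC iXY.
have iZX := integrable_products_mull Ut1^T iXX.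
have iXZ := integrable_productsC iZX.
exists (fun t => (w^T *m X t) 0 0); split; last first.
  apply: optimal_linear_predictor_unique => // v.
  exact: spd_sqrt_form_gt0 Q_sqrt.
have -> : (fun t => (w^T *m X t) 0 0) = (fun t => (c^T *m (Ut1^T *m X t)) 0 0).
  by apply/funext => t; rewrite mulmxA -trmx_mul.
have covZ : covmx P (fun t => Ut1^T *m X t) (fun t => Ut1^T *m X t) =
    Ut1^T *m covmx P X X *m Ut1.
  by rewrite covmx_mull// covmx_mulr// trmxK mulmxA.
apply: optimal_linear_predictor_unique => //.
- exact/integrable_productsC/integrable_products_mull.
- exact: integrable_products_mull.
(* Positivity passes from [X] to the feature because [Ut1] has full column rank, so that [Ut1 *m v]
   is nonzero. *)
- move=> v v0; rewrite covZ.
  have -> : v^T *m (Ut1^T *m covmx P X X *m Ut1) *m v =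
      (Ut1 *m v)^T *m covmx P X X *m (Ut1 *m v) by rewrite trmx_mul !mulmxA.
  apply: (spd_sqrt_form_gt0 Q_sqrt); apply: contra v0 => /eqP Uv.
  have rU : row_free Ut1^T by rewrite /row_free mxrank_tr Ut1_def rank_mull_unit// rPt1.
  rewrite -trmx_eq0 -(mulmx_free_eq0 _ rU) -trmx_mul Uv trmx0//.
(* The normal equations for the feature are those for [X] multiplied on the left by [Ut1^T]. *)
- by rewrite covZ -mulmxA -/w -mulmxA wE covmx_mull.
Qed.
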